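(* Let $d\ge 1$, let $\Omega\subset\mathbb{R}^d$ be a bounded domain, let $f:\Omega\to\mathbb{R}^d$ be an input function, let $g\in\mathbb{R}^d$ and let $R\in\mathbb{R}^{d\times d}$ be an orthogonal matrix. Define $\tilde\Omega:=\{Rx+g:x\in\Omega\}$ and $\tilde f:\tilde\Omega\to\mathbb{R}^d$ by $\tilde f(Rx+g):=Rf(x)$. Let $\tilde{\mathcal{G}}[\,\cdot\,;\theta]$ be the INO-vector operator with output $\bm{x}(x,L\tau)$ described in the context, with any fixed parameter set $\theta$. Then for every $x\in\Omega$, $$\tilde{\mathcal{G}}[\tilde f;\theta](Rx+g)=R\,\tilde{\mathcal{G}}[f;\theta](x)+g,$$ where the left-hand side is computed on $\tilde\Omega$ and the right-hand side on $\Omega$. That is, this architecture is translation- and rotation-equivariant.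
   Context: INO-vector architecture with equivariant projection. Fix integers $d_h\ge1$, $L\ge1$, a fictitious time step $\tau>0$, and an activation function $\sigma:\mathbb{R}\to\mathbb{R}$ (applied componentwise). The parameter set $\theta$ consists of $P,p\in\mathbb{R}^{d_h}$, $W\in\mathbb{R}^{d_h\times d_h}$, $c\in\mathbb{R}^{d_h}$, a kernel function $\kappa(\cdot;v)$ with values in $\mathbb{R}^{d_h\times d_h}$, and a scalar-valued function $\phi(\cdot;w):\mathbb{R}^{d_h}\to\mathbb{R}$. Edge encoding: for points $x,y$ of the domain, $\overline{y-x}$ denotes a frame-invariant encoding of the edge from $x$ to $y$; in 2D, $\overline{y-x}:=[|y-x|\cos\vartheta,\ |y-x|\sin\vartheta]$, with $|\cdot|$ the Euclidean norm and $\vartheta$ the orientation of $y-x$ relative to a local reference edge fixed in the body (e.g. the vector between two fixed nodes of the undeformed configuration); in 3D it is built analogously from $|y-x|$ and two orientation angles. Since the reference edge moves with the body, the encoding attached to $(Rx+g,Ry+g)$ in the transformed frame coincides with $\overline{y-x}$. Given an input $f$ on a domain $\Omega$, define: $h(x,0):=P|f(x)|+p$, $\bm{x}(x,0):=x$; $m(x,y):=\kappa(\overline{y-x},|f(x)|,|f(y)|;v)$; for $j=0,\dots,L-1$, $$h(x,(j+1)\tau):=h(x,j\tau)+\tau\,\sigma\Big(Wh(x,j\tau)+\int_\Omega m(x,y)h(y,j\tau)\,dy+c\Big),$$ $$\bm{x}(x,(j+1)\tau):=\bm{x}(x,j\tau)+\tau\int_\Omega (x-y)\,\phi\big(m(x,y)h(y,j\tau);w\big)\,dy;$$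 output $\tilde{\mathcal{G}}[f;\theta](x):=\bm{x}(x,L\tau)$. All integrals are assumed to exist. *)

(* Defs.v *)
From HB Require Import structures.
From mathcomp Require Import all_boot all_order all_algebra.
From mathcomp Require Import all_classical all_reals all_analysis.
Set Implicit Arguments. Unset Strict Implicit. Unset Printing Implicit Defensive.
Import Order.TTheory GRing.Theory Num.Theory.
Import numFieldNormedType.Exports.
Local Open Scope classical_set_scope.
Local Open Scope ring_scope.

(* Points of R^d are column vectors 'cV[R]_d.  We equip 'cV[R]_d with the
   product (= Borel) sigma-algebra generated by the coordinate projections. *)
Definition cV_display : measure_display. Proof. exact: default_measure_display. Qed.

Section cV_measurable.
Variables (R : realType) (d : nat).

Definition cV_coord (i : 'I_d) : 'cV[R]_d -> R := fun x => x i 0.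

Let cV_set0 : g_sigma_preimage cV_coord set0.
Proof. exact: sigma_algebra0. Qed.
Let cV_setC A : g_sigma_preimage cV_coord A -> g_sigma_preimage cV_coord (~` A).
Proof. exact: sigma_algebraC. Qed.
Let cV_bigcup (F : (set 'cV[R]_d)^nat) :
  (forall i, g_sigma_preimage cV_coord (F i)) ->
  g_sigma_preimage cV_coord (\bigcup_i (F i)).
Proof. exact: sigma_algebra_bigcup. Qed.

HB.instance Definition _ := @isMeasurable.Build cV_display
  'cV[R]_d (g_sigma_preimage cV_coord) cV_set0 cV_setC cV_bigcup.
End cV_measurable.

(* mu is the d-dimensional Lebesgue measure: it gives every half-open box
   prod_i ]a_i, b_i] the volume prod_i (b_i - a_i).  (This determines mu
   uniquely on the Borel sets.) *)
Definition is_lebesgue_measure (R : realType) (d : nat)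
  (mu : {measure set 'cV[R]_d -> \bar R}) : Prop :=
  forall a b : 'cV[R]_d, (forall i, a i 0 <= b i 0) ->
    mu [set x | forall i, a i 0 < x i 0 <= b i 0] =
    ((\prod_(i < d) (b i 0 - a i 0))%:E)%E.

Definition enorm (R : realType) (n : nat) (v : 'cV[R]_n) : R :=
  Num.sqrt (\sum_(i < n) v i 0 ^+ 2).

Definition orthogonal_mx (R : realType) (n : nat) (M : 'M[R]_n) : Prop :=
  M^T *m M = 1%:M.

Definition vintegral (R : realType) (d k : nat)
  (mu : {measure set 'cV[R]_d -> \bar R}) (D : set 'cV[R]_d)
  (F : 'cV[R]_d -> 'cV[R]_k) : 'cV[R]_k :=
  \col_(i < k) Rintegral mu D (fun y => F y i 0).

(* Parameter set theta (the kernel parameter v and the phi parameter w are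
   absorbed into the arbitrary functions kappa and phi).  The edge encoding
   takes values in an arbitrary type E. *)
Record ino_params (R : realType) (dh : nat) (E : Type) := InoParams {
  par_P : 'cV[R]_dh;
  par_p : 'cV[R]_dh;
  par_W : 'M[R]_dh;
  par_c : 'cV[R]_dh;
  par_kappa : E -> R -> R -> 'M[R]_dh;
  par_phi : 'cV[R]_dh -> R
}.

Section INO.
Variables (R : realType) (d dh : nat) (E : Type).
Variables (sigma : R -> R) (tau : R) (th : ino_params R dh E).
Variables (mu : {measure set 'cV[R]_d -> \bar R}).
(* the domain, its edge encoding  enc x y = \overline{y - x}, and the input *)
Variables (Om : set 'cV[R]_d) (enc : 'cV[R]_d -> 'cV[R]_d -> E)
          (f : 'cV[R]_d -> 'cV[R]_d).

Definition ino_m (x y : 'cV[R]_d) : 'M[R]_dh :=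
  par_kappa th (enc x y) (enorm (f x)) (enorm (f y)).

Fixpoint ino_h (j : nat) : 'cV[R]_d -> 'cV[R]_dh :=
  match j with
  | 0 => fun x => enorm (f x) *: par_P th + par_p th
  | j'.+1 => fun x =>
      ino_h j' x + tau *: map_mx sigma
        (par_W th *m ino_h j' x
         + vintegral mu Om (fun y => ino_m x y *m ino_h j' y) + par_c th)
  end.

Fixpoint ino_x (j : nat) : 'cV[R]_d -> 'cV[R]_d :=
  match j with
  | 0 => fun x => x
  | j'.+1 => fun x =>
      ino_x j' x + tau *: vintegral mu Om
        (fun y => par_phi th (ino_m x y *m ino_h j' y) *: (x - y))
  end.

End INO.

Definition ino_vector (R : realType) (d dh : nat) (E : Type)
  (L : nat) (sigma : R -> R) (tau : R) (th : ino_params R dh E)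
  (mu : {measure set 'cV[R]_d -> \bar R}) (Om : set 'cV[R]_d)
  (enc : 'cV[R]_d -> 'cV[R]_d -> E) (f : 'cV[R]_d -> 'cV[R]_d)
  : 'cV[R]_d -> 'cV[R]_d :=
  ino_x sigma tau th mu Om enc f L.

Definition ino_integrals_exist (R : realType) (d dh : nat) (E : Type)
  (L : nat) (sigma : R -> R) (tau : R) (th : ino_params R dh E)
  (mu : {measure set 'cV[R]_d -> \bar R}) (Om : set 'cV[R]_d)
  (enc : 'cV[R]_d -> 'cV[R]_d -> E) (f : 'cV[R]_d -> 'cV[R]_d) : Prop :=
  forall j : nat, (j < L)%N -> forall x, Om x ->
    (forall i : 'I_dh, mu.-integrable Om
       (fun y => ((ino_m th enc f x y *m ino_h sigma tau th mu Om enc f j y) i 0)%:E))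
    /\
    (forall i : 'I_d, mu.-integrable Om
       (fun y => ((par_phi th (ino_m th enc f x y *m ino_h sigma tau th mu Om enc f j y)
                    *: (x - y)) i 0)%:E)).

(* Main.v *)
(** Lebesgue measure on R^d is invariant under x |-> Q x + g.  For translations
    this holds on half-open boxes, hence everywhere by uniqueness; the orthogonal
    part follows from a Tonelli argument against the Euclidean unit ball.
    Changing variables in the integrals then shows, by induction on the layer,
    that the features h agree at x and Q x + g, since they depend on f only
    through |f| and the encoded edges.  The increments of x are integrals of
    x - y with scalar weights built from h, so they are multiplied by Q. *)

Require Import Defs.
From HB Require Import structures.
From mathcomp Require Import all_boot all_order all_algebra.
From mathcomp Require Import all_classical all_reals all_analysis.
Import Order.TTheory GRing.Theory Num.Theory.
Import numFieldNormedType.Exports.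
Import measurable_realfun.
Local Open Scope classical_set_scope.
Local Open Scope ring_scope.

(** * Half-open boxes and the Borel sets of ['cV[R]_d] *)

Section cV_boxes.
Set Implicit Arguments. Unset Strict Implicit. Unset Printing Implicit Defensive.
Context {R : realType} {d : nat}.
Implicit Types (a b x : 'cV[R]_d).

Lemma measurable_cV_coord (i : 'I_d) :
  measurable_fun setT (fun x : 'cV[R]_d => x i 0).
Proof.
move=> _ A mA; rewrite setTI; apply: sub_sigma_algebra.
by rewrite (bigD1 i)//=; left; exists A => //; rewrite setTI.
Qed.

(** The sigma-algebra on columns is generated by the coordinate preimages, so only these generators
    have to be tested. *)
Lemma measurable_fun_cV d' (T : measurableType d') (F : T -> 'cV[R]_d) :
  (forall i, measurable_fun setT (fun t => F t i 0)) -> measurable_fun setT F.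
Proof.
move=> mF; apply: (measurability (\big[setU/set0]_(i < d)
  preimage_set_system setT (@cV_coord R d i) measurable)) => // _ [B + <-].
move: B; apply: (big_ind (fun G : set (set 'cV[R]_d) => forall B, G B ->
  measurable ([set: T] `&` F @^-1` B))) => //.
  by move=> G H mG mH B [/mG|/mH].
by move=> i _ _ [A mA <-]; rewrite [_ `&` _ @^-1` A]setTI; exact: mF.
Qed.

Definition cV_box a b : set 'cV[R]_d :=
  [set x | forall i, a i 0 < x i 0 <= b i 0].

Definition cV_boxes : set (set 'cV[R]_d) := range (fun ab => cV_box ab.1 ab.2).

Lemma cV_boxesI : setI_closed cV_boxes.
Proof.
move=> _ _ [[a b] _ <-] [[a' b'] _ <-] /=.
exists (\col_i Num.max (a i 0) (a' i 0), \col_i Num.min (b i 0) (b' i 0)) => //.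
apply/seteqP; split => x /=.
  move=> h; split => i; have := h i; rewrite !mxE gt_max le_min;
  by case/andP => /andP[? ?] /andP[? ?]; apply/andP.
by move=> [h h'] i; rewrite !mxE gt_max le_min andbACA h h'.
Qed.

Lemma measurable_cV_box a b : measurable (cV_box a b).
Proof.
rewrite (_ : cV_box a b = \bigcap_(i in [set: 'I_d])
    ((fun x : 'cV[R]_d => x i 0) @^-1` `]a i 0, b i 0])); last first.
  apply/seteqP; split => x /= h i; first by move=> _ /=; rewrite in_itv /= h.
  by have := h i I; rewrite /= in_itv.
apply: fin_bigcap_measurable => // i _.
by rewrite -[X in measurable X]setTI; exact: measurable_cV_coord.
Qed.

(** An exhaustion of the space by boxes of finite volume, as sigma-finiteness and the uniqueness
    theorem for measures require. *)
Definition cV_cube (n : nat) : set 'cV[R]_d :=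
  cV_box (const_mx (- n%:R)) (const_mx n%:R).

Lemma bigcup_cV_cube : \bigcup_n cV_cube n = setT.
Proof.
apply/seteqP; split => // x _.
have h (i : 'I_d) : `|x i 0| < (\sum_i `|x i 0| + 1).
  by rewrite ltr_pwDr// (bigD1 i)//= lerDl sumr_ge0.
exists (Num.truncn (\sum_i `|x i 0| + 1)).+1 => // i; rewrite !mxE.
have : `|x i 0| < (Num.truncn (\sum_i `|x i 0| + 1)).+1%:R.
  by rewrite (lt_trans (h i))// truncnS_gt.
by rewrite ltr_norml => /andP[-> /ltW ->].
Qed.

(** Boxes are Borel; conversely, the identity is measurable from the sigma-algebra generated by
    boxes, because each of its coordinates is. With [cV_boxesI] this makes the boxes a generating
    pi-system. *)
Lemma measurable_cV_boxesE : @measurable _ 'cV[R]_d = <<s cV_boxes >>.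
Proof.
apply/seteqP; split; last first.
  apply: smallest_sub; first exact: sigma_algebra_measurable.
  by move=> _ [[a b] _ <-]; exact: measurable_cV_box.
suff mid : measurable_fun setT
    (idfun : g_sigma_algebraType cV_boxes -> 'cV[R]_d).
  by move=> A mA; have := mid measurableT _ mA; rewrite setTI.
apply: measurable_fun_cV => i.
apply: (measurability (@ocitv R)) => // _ [_ [[a b] _ <-] <-] /=.
rewrite setTI.
(* The slab where coordinate [i] lies in []a, b]] is exhausted by boxes whose other sides are []-n,
   n]]. *)
rewrite (_ : _ @^-1` _ = \bigcup_n cV_box
    (\col_j if j == i then a else - n%:R) (\col_j if j == i then b else n%:R)).
  by apply: bigcupT_measurable => n; apply: sub_sigma_algebra; eexists (_, _).
apply/seteqP; split => x /=.
  rewrite in_itv /= => xab; have [n _ xn] : (\bigcup_n cV_cube n) x.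
    by rewrite bigcup_cV_cube.
  exists n => // j; rewrite !mxE; case: eqP => [->//|_].
  by have := xn j; rewrite !mxE.
by move=> [n _ /(_ i)]; rewrite !mxE eqxx in_itv.
Qed.

(** An open set is the union of the boxes with rational corners that it contains, and there are
    countably many of these. *)
Lemma open_cV_measurable (A : set 'cV[R]_d) : open A -> measurable A.
Proof.
move=> oA.
pose B (q : 'cV[rat]_d * 'cV[rat]_d) := cV_box (map_mx ratr q.1) (map_mx ratr q.2).
rewrite (_ : A = \bigcup_q (if `[< B q `<=` A >] then B q else set0)).
  apply: countable_bigcupT_measurable => // q; case: ifP => // _.
  exact: measurable_cV_box.
apply/seteqP; split => x; last first.
  by move=> [q _]; case: ifPn => // /asboolP; exact.
move=> Ax; have /nbhs_ballP[e /= e0 eA] := open_nbhs_nbhs (conj oA Ax).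
(* Each rational corner is within [e] of [x] in every coordinate. Balls of the matrix norm are
   tested entrywise, so the resulting box stays inside the ball. *)
have /choice[p hp] : forall i : 'I_d, exists q : rat, x i 0 - e < ratr q < x i 0.
  move=> i; have /rat_in_itvoo[q] : x i 0 - e < x i 0 by rewrite ltrBlDr ltrDl.
  by rewrite in_itv /=; exists q.
have /choice[r hr] : forall i : 'I_d, exists q : rat, x i 0 < ratr q < x i 0 + e.
  move=> i; have /rat_in_itvoo[q] : x i 0 < x i 0 + e by rewrite ltrDl.
  by rewrite in_itv /=; exists q.
exists (\col_i p i, \col_i r i) => //.
rewrite ifT; first by move=> i /=; rewrite !mxE; have /andP[_ ->] := hp i;
  have /andP[/ltW -> _] := hr i.
apply/asboolP => y yB; apply: eA; split => // i j; rewrite ord1.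
have := yB i; rewrite /= !mxE => /andP[py yr].
have /andP[xp _] := hp i; have /andP[_ rx] := hr i.
rewrite /ball /= ltr_distlC.
by rewrite (lt_trans xp py) (le_lt_trans yr rx).
Qed.
End cV_boxes.

(** * Invariance of Lebesgue measure under translations and orthogonal maps *)

Section lebesgue_invariance.
Set Implicit Arguments. Unset Strict Implicit. Unset Printing Implicit Defensive.
Context {R : realType} {d : nat}.
Variable mu : {measure set 'cV[R]_d -> \bar R}.
Hypothesis hmu : is_lebesgue_measure mu.

(** The truncation at 0 covers boxes with reversed bounds, which are empty, so that box volumes can
    be compared without a side condition. *)
Lemma lebesgue_cV_box (a b : 'cV[R]_d) :
  mu (cV_box a b) = ((\prod_i Num.max 0 (b i 0 - a i 0))%:E)%E.
Proof.
have [ab|/existsNP[i /negP]] := pselect (forall i, a i 0 <= b i 0).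
  rewrite hmu//; congr (_%:E); apply: eq_bigr => i _.
  by rewrite max_r// subr_ge0.
rewrite -ltNge => ba; rewrite (_ : cV_box a b = set0).
  by rewrite measure0 (bigD1 i)//= max_l ?mul0r// subr_le0 ltW.
rewrite -subset0 => x /(_ i) /andP[ax xb].
by have := lt_trans (lt_le_trans ax xb) ba; rewrite ltxx.
Qed.

Lemma lebesgue_cV_cube_lty n : (mu (cV_cube n) < +oo)%E.
Proof. by rewrite lebesgue_cV_box ltry. Qed.

Lemma lebesgue_cV_sigma_finite : sigma_finite setT mu.
Proof.
exists cV_cube; first by rewrite bigcup_cV_cube.
by move=> n; split; [exact: measurable_cV_box|exact: lebesgue_cV_cube_lty].
Qed.

Lemma measurable_fun_mulmxD d' (T : measurableType d') (M : 'M[R]_d)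
    (F G : T -> 'cV[R]_d) : measurable_fun setT F -> measurable_fun setT G ->
  measurable_fun setT (fun t => M *m F t + G t).
Proof.
move=> mF mG; have mc (H : T -> 'cV[R]_d) : measurable_fun setT H ->
    forall i : 'I_d, measurable_fun setT (fun t : T => H t i 0 : R).
  by move=> mH i; exact: (measurableT_comp (measurable_cV_coord i) mH).
apply: measurable_fun_cV => i; under eq_fun do rewrite !mxE.
apply: measurable_funD; last exact: mc.
by apply: measurable_sum => j; apply: measurable_funM => //; exact: mc.
Qed.

Lemma measurable_affine_cV (M : 'M[R]_d) (t : 'cV[R]_d) :
  measurable_fun setT (fun x : 'cV[R]_d => M *m x + t).
Proof. exact: measurable_fun_mulmxD. Qed.

Lemma measurable_translation_cV (t : 'cV[R]_d) :
  measurable_fun setT (fun x : 'cV[R]_d => x + t).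
Proof.
by have := measurable_affine_cV 1%:M t; under eq_fun do rewrite mul1mx.
Qed.

Lemma preimage_translation_box (t a b : 'cV[R]_d) :
  (fun x => x + t) @^-1` cV_box a b = cV_box (a - t) (b - t).
Proof.
by apply/seteqP; split => x h i; have := h i; rewrite !mxE ltrBlDr lerBrDr.
Qed.

Lemma lebesgue_translation (t : 'cV[R]_d) (A : set 'cV[R]_d) :
  measurable A -> mu ((fun x => x + t) @^-1` A) = mu A.
Proof.
have mt := measurable_translation_cV t.

(* The pushforward of [mu] is taken with its measure structure; it agrees with [mu] on the pi-system
   of boxes and is finite on the cubes. *)
pose nu := measure_function_pushforward__canonical__measure_function_Measure mu mt.
have nuE a b : nu (cV_box a b) = mu (cV_box (a - t) (b - t)).
  by rewrite -preimage_translation_box.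
move=> mA; rewrite -[LHS]/(nu A).
apply: (measure_unique cV_boxes cV_cube measurable_cV_boxesE _ _ _ nu mu) => //.
- exact: cV_boxesI.
- by move=> n; eexists (_, _).
- exact: bigcup_cV_cube.
- move=> _ [[a b] _ <-] /=; rewrite nuE !lebesgue_cV_box; congr (_%:E).
  by apply: eq_bigr => i _; rewrite !mxE opprB addrA subrK.
- by move=> n; rewrite nuE lebesgue_cV_box ltry.
Qed.

(** Tonelli for the indicator of [S]. The sigma-finiteness proved above is packed onto [mu] to build
    the product measure. *)
Lemma integral_xsection_ysection (S : set ('cV[R]_d * 'cV[R]_d)) : measurable S ->
  (\int[mu]_x mu (xsection S x) = \int[mu]_y mu (ysection S y))%E.
Proof.
move=> mS.
pose sf := isSFinite.Build _ _ _ (Measure.sort mu)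
  (sfinite_measure_sigma_finite lebesgue_cV_sigma_finite).
pose sg := isSigmaFinite.Build _ _ _ (Measure.sort mu) lebesgue_cV_sigma_finite.
pose m : {sigma_finite_measure set 'cV[R]_d -> \bar R} :=
  HB.pack (Measure.sort mu) sf sg.
have := indic_fubini_tonelli m m mS.
by rewrite indic_fubini_tonelli_FE// indic_fubini_tonelli_GE.
Qed.

(** The Euclidean ball is spelled out because the balls of the matrix norm are cubes, which
    rotations do not preserve. *)
Definition unit_ball_cV : set 'cV[R]_d := [set x | \sum_i x i 0 ^+ 2 < 1].

Lemma measurable_unit_ball_cV : measurable unit_ball_cV.
Proof.
rewrite (_ : unit_ball_cV =
  (fun x : 'cV[R]_d => \sum_i x i 0 ^+ 2) @^-1` `]-oo, 1[); last first.
  by apply/seteqP; split => x; rewrite /= in_itv.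
rewrite -[X in measurable X]setTI; apply: measurable_sum => // i.
by apply: measurable_funX; exact: measurable_cV_coord.
Qed.

Lemma lebesgue_unit_ball_cV_gt0 : (0 < mu unit_ball_cV)%E.
Proof.
(* As [e <= 1], points of the cube of half-side [e] have square sum at most
   [d * e ^+ 2 <= d * e = d / (d + 1) < 1]. *)
pose e : R := d.+1%:R^-1.
have e0 : 0 < e by rewrite invr_gt0 ltr0n.
apply: (@lt_le_trans _ _ (mu (cV_box (const_mx (- e)) (const_mx e)))).
  rewrite lebesgue_cV_box lte_fin prodr_gt0// => i _.
  by rewrite !mxE opprK lt_max addr_gt0 ?orbT.
apply: le_measure; rewrite ?inE;
  [exact: measurable_cV_box|exact: measurable_unit_ball_cV|].
move=> x xe; rewrite /unit_ball_cV /=.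
have /le_lt_trans : \sum_i x i 0 ^+ 2 <= \sum_(i < d) e.
  apply: ler_sum => i _; have := xe i; rewrite !mxE => /andP[/ltW ex xe'].
  rewrite -real_normK ?num_real// (@le_trans _ _ (e ^+ 2))//.
    by rewrite ler_sqr ?nnegrE ?(ltW e0)// ler_norml ex.
  by rewrite expr2 ler_piMl ?(ltW e0)// invf_le1 ?ltr0n// ler1n.
apply; rewrite sumr_const card_ord -mulr_natl ltr_pdivrMr ?ltr0n// mul1r.
by rewrite ltr_nat.
Qed.

Lemma lebesgue_unit_ball_cV_lty : (mu unit_ball_cV < +oo)%E.
Proof.
apply: le_lt_trans (lebesgue_cV_cube_lty 1).
apply: le_measure; rewrite ?inE;
  [exact: measurable_unit_ball_cV|exact: measurable_cV_box|].
move=> x x1 i; rewrite !mxE.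
have : `|x i 0| < 1.
  rewrite -(@ltr_pXn2r _ 2)// ?nnegrE// expr1n real_normK ?num_real//.
  apply: le_lt_trans x1; rewrite (bigD1 i)//= lerDl sumr_ge0// => j _.
  exact: sqr_ge0.
by rewrite ltr_norml => /andP[-> /ltW].
Qed.

Lemma orthogonal_mxC (Q : 'M[R]_d) : orthogonal_mx Q -> Q *m Q^T = 1%:M.
Proof. exact: mulmx1C. Qed.

Lemma sum_sqr_orthogonal n (Q : 'M[R]_n) (x : 'cV[R]_n) :
  orthogonal_mx Q ->
  \sum_i (Q *m x) i 0 ^+ 2 = \sum_i x i 0 ^+ 2.
Proof.
have sqE (y : 'cV[R]_n) : \sum_i y i 0 ^+ 2 = (y^T *m y) 0 0.
  by rewrite !mxE; apply: eq_bigr => i _; rewrite !mxE expr2.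
by move=> hQ; rewrite !sqE trmx_mul mulmxA -(mulmxA x^T) hQ mulmx1.
Qed.


Lemma integral_cst_on (A : set 'cV[R]_d) (c : \bar R) : measurable A ->
  (\int[mu]_x (if x \in A then c else 0) = c * mu A)%E.
Proof. by move=> mA; rewrite -integral_cst// [RHS]integral_mkcond. Qed.

(* By translation invariance of mu, integrating 1_E(x) 1_B(Q y + x) over y first
   gives mu(E) mu(Q^-1 B), and over x first (then x := x - Q y) it gives
   mu(B) mu(E), as the Euclidean ball E satisfies Q E = E = - E. *)
Lemma lebesgue_orthogonal (Q : 'M[R]_d) (B : set 'cV[R]_d) : orthogonal_mx Q ->
  measurable B -> mu (mulmx Q @^-1` B) = mu B.
Proof.
move=> hQ mB; have hQ' := orthogonal_mxC hQ.
pose E := unit_ball_cV.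
pose S := [set p : 'cV[R]_d * 'cV[R]_d | E p.1 /\ B (Q *m p.2 + p.1)].
(* [S'] is the image of [S] under the shear sending [(x, y)] to [(Q y + x, y)], which translates
   each horizontal section. *)
pose S' := [set p : 'cV[R]_d * 'cV[R]_d | E ((- Q) *m p.2 + p.1) /\ B p.1].
have mE : measurable E := measurable_unit_ball_cV.
have mpre d' (T : measurableType d') (F : T -> 'cV[R]_d) A :
    measurable_fun setT F -> measurable A -> measurable (F @^-1` A).
  by move=> mF mA; rewrite -[X in measurable X]setTI; exact: mF.
have mS : measurable S.
  apply: measurableI; first exact: mpre.
  by apply: mpre => //; exact: measurable_fun_mulmxD.
have mS' : measurable S'.
  apply: measurableI; last exact: mpre.
  by apply: mpre => //; exact: measurable_fun_mulmxD.
have mQB : measurable (mulmx Q @^-1` B).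
  apply: mpre => //; have := measurable_affine_cV Q 0.
  by under eq_fun do rewrite addr0.
have xS x : mu (xsection S x) = if x \in E then mu (mulmx Q @^-1` B) else 0%E.
  case: ifPn => [/set_mem Ex|/negP Ex].
    rewrite -[RHS](lebesgue_translation (Q^T *m x))//; congr (mu _).
    apply/seteqP; split => y; rewrite /xsection /= inE /S /= mulmxDr mulmxA hQ' mul1mx.
      by case.
    by split.
  rewrite (_ : xsection S x = set0) ?measure0// -subset0 => y.
  by rewrite /xsection /= inE => -[/mem_set].
have yS y : mu (ysection S y) = mu (ysection S' y).
  rewrite -[RHS](lebesgue_translation (Q *m y)); last exact: measurable_ysection.
  congr (mu _); apply/seteqP; split => x; rewrite /ysection /= !inE /S /S' /=;
  by rewrite mulNmx [- _ + _]addrC addrK [Q *m y + x]addrC.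
have xS' x : mu (xsection S' x) = if x \in B then mu E else 0%E.
  case: ifPn => [/set_mem Bx|/negP Bx].
    rewrite -[RHS](lebesgue_translation (- (Q^T *m x)))//; congr (mu _).
    have eqE y : E ((- Q) *m y + x) = E (y - Q^T *m x).
      rewrite /E /unit_ball_cV /= -(sum_sqr_orthogonal (y - _) hQ).
      rewrite mulmxBr mulmxA hQ' mul1mx; congr (is_true (_ < 1)).
      by apply: eq_bigr => i _; rewrite mulNmx addrC -opprB !mxE sqrrN.
    apply/seteqP; split => y; rewrite /xsection /= inE /S' /= eqE; first by case.
    by split.
  rewrite (_ : xsection S' x = set0) ?measure0// -subset0 => y.
  by rewrite /xsection /= inE => -[_ /mem_set].
have : (mu E * mu (mulmx Q @^-1` B) = mu E * mu B)%E.
  rewrite muleC -!integral_cst_on//.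
  under eq_integral do rewrite -xS.
  under [RHS]eq_integral do rewrite -xS'.
  by rewrite !integral_xsection_ysection//; apply: eq_integral => y _.
(* Cancelling the factor [mu E] requires it to be finite and positive. *)
have Efin : mu E \is a fin_num.
  by rewrite ge0_fin_numE// lebesgue_unit_ball_cV_lty.
have E0 := lebesgue_unit_ball_cV_gt0.
move=> /eqP; rewrite eq_le => /andP[].
by rewrite !lee_pmul2l// => h1 h2; apply/eqP; rewrite eq_le h1.
Qed.

Lemma lebesgue_isometry (Q : 'M[R]_d) (t : 'cV[R]_d) (B : set 'cV[R]_d) :
  orthogonal_mx Q -> measurable B -> mu ((fun x => Q *m x + t) @^-1` B) = mu B.
Proof.
move=> hQ mB.
have mtB : measurable ((fun x : 'cV[R]_d => x + t) @^-1` B).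
  by rewrite -[X in measurable X]setTI; exact: measurable_translation_cV.
by rewrite -[RHS](lebesgue_translation t)// -(lebesgue_orthogonal hQ mtB).
Qed.

(** * Change of variables along an affine isometry *)

Section change_of_variables.
Variables (Q : 'M[R]_d) (t : 'cV[R]_d) (hQ : orthogonal_mx Q).
Let T (x : 'cV[R]_d) := Q *m x + t.
Variable D : set 'cV[R]_d.
Hypothesis mD : measurable D.

Lemma preimage_image_isometry : T @^-1` (T @` D) = D.
Proof.
apply/seteqP; split => x; last by exists x.
move=> [y Dy /addIr /(congr1 (mulmx Q^T))].
by rewrite !mulmxA hQ !mul1mx => <-.
Qed.

(** The image is also the preimage of [D] under the inverse isometry, which is again affine. *)
Lemma measurable_image_isometry : measurable (T @` D).
Proof.
have hQ' := orthogonal_mxC hQ.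
rewrite (_ : T @` D = (fun x => Q^T *m x + (- (Q^T *m t))) @^-1` D).
  by rewrite -[X in measurable X]setTI; exact: measurable_affine_cV.
apply/seteqP; split => x /=.
  by move=> [y Dy <-]; rewrite /T mulmxDr mulmxA hQ mul1mx addrK.
move=> Dx; exists (Q^T *m x - Q^T *m t) => //.
by rewrite /T mulmxBr !mulmxA hQ' !mul1mx subrK.
Qed.

(** The pushforward of [mu] along [T] is [mu] itself, which settles nonnegative integrands; the
    general case splits into positive and negative parts. *)
Lemma integral_isometry (f : 'cV[R]_d -> \bar R) : measurable_fun (T @` D) f ->
  (\int[mu]_(x in T @` D) f x = \int[mu]_(x in D) f (T x))%E.
Proof.
have ge0 (h : 'cV[R]_d -> \bar R) : measurable_fun (T @` D) h ->
    (forall x, 0 <= h x)%E ->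
    (\int[mu]_(x in T @` D) h x = \int[mu]_(x in D) h (T x))%E.
  move=> mh h0; have mT : measurable_fun setT T by exact: measurable_affine_cV.
  have := ge0_integral_pushforward mT mu measurable_image_isometry mh (in1W h0).
  rewrite preimage_image_isometry => <-.
  pose nu := measure_function_pushforward__canonical__measure_function_Measure mu mT.
  apply: (eq_measure_integral nu) => A mA _.
  by rewrite -(lebesgue_isometry t hQ mA).
move=> mf; rewrite -[RHS]/(\int[mu]_(x in D) (f \o T) x)%E.
rewrite integralE [RHS]integralE (funepos_comp f T) (funeneg_comp f T) !ge0//.
- exact: measurable_funeneg.
- exact: measurable_funepos.
Qed.

Lemma vintegral_isometry k (F F' : 'cV[R]_d -> 'cV[R]_k) :
  (forall i, mu.-integrable (T @` D) (fun y => (F y i 0)%:E)) ->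
  (forall y, D y -> F (T y) = F' y) ->
  vintegral mu (T @` D) F = vintegral mu D F'.
Proof.
move=> iF FF'; apply/matrixP => i j; rewrite !mxE; congr fine.
rewrite integral_isometry; last exact: measurable_int (iF i).
by apply: eq_integral => y /set_mem Dy; rewrite FF'.
Qed.

End change_of_variables.

(** Linearity of the integral, used to pull the orthogonal matrix out of the position increments. *)
Lemma vintegral_mulmx (D : set 'cV[R]_d) k n (M : 'M[R]_(n, k))
    (F : 'cV[R]_d -> 'cV[R]_k) : measurable D ->
  (forall i, mu.-integrable D (fun y => (F y i 0)%:E)) ->
  vintegral mu D (fun y => M *m F y) = M *m vintegral mu D F.
Proof.
move=> mD iF; apply/matrixP => i j; rewrite !mxE.
have iMF l : mu.-integrable D (fun y => (M i l * F y l 0)%:E).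
  by under eq_fun do rewrite EFinM; exact: integrableZl.
rewrite /Rintegral; under eq_integral do rewrite mxE -sumEFin.
(* [fine] commutes with sums of finite values; integrability of each term gives this finiteness. *)
rewrite integral_sum// -sum_fine; last first.
  by move=> l _; exact: (integrable_fin_num mD (iMF l)).
apply: eq_bigr => l _; rewrite mxE -RintegralZl//; exact: iF.
Qed.

End lebesgue_invariance.

(** * Invariance of the features and equivariance of the positions *)

Section ino_equivariance.
Set Implicit Arguments. Unset Strict Implicit. Unset Printing Implicit Defensive.
Variables (R : realType) (d dh L : nat) (tau : R) (sigma : R -> R) (E : Type).
Variables (theta : ino_params R dh E) (mu : {measure set 'cV[R]_d -> \bar R}).
Hypothesis hmu : is_lebesgue_measure mu.
Variables (Om : set 'cV[R]_d) (mOm : measurable Om).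
Variables (f ft : 'cV[R]_d -> 'cV[R]_d) (enc enct : 'cV[R]_d -> 'cV[R]_d -> E).
Variables (g : 'cV[R]_d) (Q : 'M[R]_d).
Hypothesis hQ : orthogonal_mx Q.
Let T (x : 'cV[R]_d) := Q *m x + g.
Hypothesis hft : forall x, Om x -> ft (T x) = Q *m f x.
Hypothesis henc : forall x y, Om x -> Om y -> enct (T x) (T y) = enc x y.
Hypothesis hint : ino_integrals_exist L sigma tau theta mu Om enc f.
Hypothesis hintt : ino_integrals_exist L sigma tau theta mu (T @` Om) enct ft.

Lemma enorm_orthogonal (v : 'cV[R]_d) : enorm (Q *m v) = enorm v.
Proof. by rewrite /enorm sum_sqr_orthogonal. Qed.

Lemma ino_m_isometry x y : Om x -> Om y ->
  ino_m theta enct ft (T x) (T y) = ino_m theta enc f x y.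
Proof. by move=> Ox Oy; rewrite /ino_m henc// !hft// !enorm_orthogonal. Qed.

Lemma vintegral_ino_m_isometry (ht h : 'cV[R]_d -> 'cV[R]_dh) x :
  (forall y, Om y -> ht (T y) = h y) -> Om x ->
  (forall i, mu.-integrable (T @` Om)
    (fun y => ((ino_m theta enct ft (T x) y *m ht y) i 0)%:E)) ->
  vintegral mu (T @` Om) (fun y => ino_m theta enct ft (T x) y *m ht y) =
  vintegral mu Om (fun y => ino_m theta enc f x y *m h y).
Proof.
move=> hth Ox ih; apply: (vintegral_isometry hmu hQ mOm ih) => y Oy.
by rewrite ino_m_isometry// hth.
Qed.

(** In [T x - T y] the shift [g] cancels, leaving [Q *m (x - y)]; the weight is an invariant scalar
    and commutes with [Q]. *)
Lemma vintegral_phi_isometry (ht h : 'cV[R]_d -> 'cV[R]_dh) x :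
  let F y := par_phi theta (ino_m theta enc f x y *m h y) *: (x - y) in
  let Ft y := par_phi theta (ino_m theta enct ft (T x) y *m ht y) *: (T x - y) in
  (forall y, Om y -> ht (T y) = h y) -> Om x ->
  (forall i, mu.-integrable Om (fun y => (F y i 0)%:E)) ->
  (forall i, mu.-integrable (T @` Om) (fun y => (Ft y i 0)%:E)) ->
  vintegral mu (T @` Om) Ft = Q *m vintegral mu Om F.
Proof.
move=> F Ft hth Ox iF iFt; rewrite -(vintegral_mulmx Q mOm iF).
apply: (vintegral_isometry hmu hQ mOm iFt) => y Oy.
rewrite /Ft /F ino_m_isometry// hth// -scalemxAr mulmxBr.
by rewrite /T opprD addrACA subrr addr0.
Qed.

(** The induction keeps [x] general, since the update at one point integrates the features of all
    others. The bound [j <= L] appears because integrability is assumed for the layers below [L]. *)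
Lemma ino_h_isometry j x : (j <= L)%N -> Om x ->
  ino_h sigma tau theta mu (T @` Om) enct ft j (T x) =
  ino_h sigma tau theta mu Om enc f j x.
Proof.
elim: j x => [|j IH] x jL Ox /=; first by rewrite hft// enorm_orthogonal.
have OTx : (T @` Om) (T x) by exists x.
have [ih _] := hintt jL OTx.
have := vintegral_ino_m_isometry (fun y => IH y (ltnW jL)) Ox ih.
by move: (IH x (ltnW jL) Ox) => -> ->.
Qed.

Lemma ino_x_isometry j x : (j <= L)%N -> Om x ->
  ino_x sigma tau theta mu (T @` Om) enct ft j (T x) =
  T (ino_x sigma tau theta mu Om enc f j x).
Proof.
elim: j x => [//|j IH] x jL Ox /=.
have OTx : (T @` Om) (T x) by exists x.
have [_ ix] := hintt jL OTx; have [_ ix'] := hint jL Ox.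
have := vintegral_phi_isometry (fun y => ino_h_isometry (ltnW jL)) Ox ix' ix.
move: (IH x (ltnW jL) Ox) => -> ->.
(* The shift [g] enters once, through the initial position; each increment is only multiplied by
   [Q]. *)
by rewrite /T mulmxDr scalemxAr addrAC.
Qed.

End ino_equivariance.

Theorem theorem3 (R : realType) (d : nat) (hd : (1 <= d)%N)
  (dh L : nat) (hdh : (1 <= dh)%N) (hL : (1 <= L)%N)
  (tau : R) (htau : 0 < tau) (sigma : R -> R)
  (E : Type) (theta : ino_params R dh E)
  (mu : {measure set 'cV[R]_d -> \bar R}) (hmu : is_lebesgue_measure mu)
  (Om : set 'cV[R]_d)
  (hOm_open : open Om) (hOm_conn : connected Om) (hOm_bdd : bounded_set Om)
  (f : 'cV[R]_d -> 'cV[R]_d) (enc : 'cV[R]_d -> 'cV[R]_d -> E)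
  (g : 'cV[R]_d) (Q : 'M[R]_d) (hQ : orthogonal_mx Q)
  (ft : 'cV[R]_d -> 'cV[R]_d) (enct : 'cV[R]_d -> 'cV[R]_d -> E)
  (hft : forall x, Om x -> ft (Q *m x + g) = Q *m f x)
  (henc : forall x y, Om x -> Om y -> enct (Q *m x + g) (Q *m y + g) = enc x y)
  (hint : ino_integrals_exist L sigma tau theta mu Om enc f)
  (hintt : ino_integrals_exist L sigma tau theta mu [set Q *m y + g | y in Om] enct ft) :
  forall x, Om x ->
    ino_vector L sigma tau theta mu [set Q *m y + g | y in Om] enct ft (Q *m x + g)
    = Q *m ino_vector L sigma tau theta mu Om enc f x + g.
Proof.
move=> x; have mOm := open_cV_measurable hOm_open.
exact: (ino_x_isometry hmu mOm hQ hft henc hint hintt).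
Qed.
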